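(* Let $q$ be a prime power and let $n,k,d$ be positive integers with $2\le k\le q-1$ and $d\le k$ such that there exists an $[n,k,d]_q$ MDS code. Put $r:=n-k$. Then $$ r = k-\log_q\big(A_q(k,d)\big).$$
   Context: An $[n,k,d]_q$ code is a linear code in $\mathbb{F}_q^n$ of dimension $k$ and minimum Hamming distance $d$; it is MDS if $n=k+d-1$. $A_q(k,d)$ is the maximum number of codewords in any $q$-ary code of length $k$ in which distinct codewords are at Hamming distance at least $d$. *)

(* Defs.v *)
From HB Require Import structures.
From mathcomp Require Import all_boot all_order all_algebra.
From mathcomp Require Import reals exp.
Set Implicit Arguments.
Unset Strict Implicit.
Unset Printing Implicit Defensive.
Import Order.TTheory GRing.Theory Num.Theory.
Local Open Scope ring_scope.

Definition prime_power (q : nat) : Prop :=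
  exists p m : nat, [/\ prime p, (0 < m)%N & q = (p ^ m)%N].

Definition hamming (Q : eqType) (n : nat) (x y : 'rV[Q]_n) : nat :=
  #|[set i : 'I_n | x ord0 i != y ord0 i]|.

(* Codes with at most one codeword satisfy this vacuously. *)
Definition distance_at_least (Q : finType) (n d : nat) (C : {set 'rV[Q]_n}) :
    bool :=
  [forall x in C, forall y in C, (x != y) ==> (d <= hamming x y)%N].

(* The distance d is exact; no such d exists for a code with at most one
   codeword. *)
Definition has_min_distance (Q : finType) (n d : nat) (C : {set 'rV[Q]_n}) :
    Prop :=
  distance_at_least d C /\
  exists x y, [/\ x \in C, y \in C, x != y & hamming x y = d].

Definition linear_code (F : finFieldType) (n k d : nat)
    (C : {vspace 'rV[F]_n}) : Prop :=
  \dim C = k /\ has_min_distance d [set x in C].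

Definition MDS_code (F : finFieldType) (n k d : nat)
    (C : {vspace 'rV[F]_n}) : Prop :=
  linear_code k d C /\ n = (k + d - 1)%N.

(* A_q(k, d): the maximum is over arbitrary, not necessarily linear, codes;
   only the size q of the alphabet matters, so 'I_q serves as alphabet. *)
Definition max_code_size (q k d : nat) : nat :=
  \max_(C : {set 'rV['I_q]_k} | distance_at_least d C) #|C|.

Definition log_base (R : realType) (b x : R) : R := ln x / ln b.

(* Main.v *)
Require Import Defs.
From mathcomp Require Import all_boot all_order all_algebra.
From mathcomp Require Import reals exp.
From mathcomp Require Import ring.
Import Order.TTheory GRing.Theory Num.Theory.
Local Open Scope ring_scope.

(** An MDS code has [n = k + d - 1], so [r = d - 1], and the claim amounts to
    [A_q(k, d) = q ^ (k - d + 1)].  The upper bound is the Singleton bound for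
    arbitrary codes.  It is attained by a Reed-Solomon code: as [k <= q], the
    polynomials of degree at most [k - d] over [F] can be evaluated at [k]
    distinct points of [F]. *)

Lemma hammingxx (Q : eqType) (n : nat) (x : 'rV[Q]_n) : hamming x x = 0%N.
Proof. by apply/eqP; rewrite cards_eq0; apply/eqP/setP => i; rewrite !inE eqxx. Qed.

Lemma card_agree_hamming (Q : eqType) (n : nat) (x y : 'rV[Q]_n) :
  (#|[set i | x ord0 i == y ord0 i]| + hamming x y)%N = n.
Proof.
rewrite -[RHS]card_ord -(cardsC [set i | x ord0 i == y ord0 i]).
by congr addn; apply: eq_card => i; rewrite !inE.
Qed.

Lemma distance_at_leastP (Q : finType) (n d : nat) (C : {set 'rV[Q]_n}) :
  reflect {in C &, forall x y, x != y -> (d <= hamming x y)%N}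
          (distance_at_least d C).
Proof.
apply: (iffP forall_inP) => [dC x y Cx Cy xy | dC x Cx].
  by have /forall_inP/(_ y Cy)/implyP := dC x Cx; apply.
by apply/forall_inP => y Cy; apply/implyP; apply: dC.
Qed.

(** Two codewords with the same first [k + 1 - d] coordinates differ in at most [d - 1] places, so
    they coincide: truncation to these coordinates is injective on [C]. *)
Lemma singleton_bound (Q : finType) (k d : nat) (C : {set 'rV[Q]_k}) :
  (0 < d)%N -> (d <= k)%N -> distance_at_least d C ->
  (#|C| <= #|Q| ^ (k.+1 - d))%N.
Proof.
move=> d0 dk /distance_at_leastP dC; set m := (k.+1 - d)%N.
have mk : (m <= k)%N by rewrite leq_subLR -add1n leq_add2r.
pose f (x : 'rV[Q]_k) : 'rV[Q]_m := \row_i x ord0 (widen_ord mk i).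
have f_inj : {in C &, injective f}.
  move=> x y Cx Cy fxy; apply/eqP/negPn/negP => xy.
  have m_agree : (m <= #|[set i | x ord0 i == y ord0 i]|)%N.
    have w_inj : injective (widen_ord mk).
      by move=> i j /(congr1 val) /= ij; apply: val_inj.
    rewrite -[m in (m <= _)%N]card_ord -cardsT -(card_imset _ w_inj).
    apply/subset_leq_card/subsetP => _ /imsetP[i _ ->]; rewrite inE.
    by move/rowP/(_ i): fxy; rewrite !mxE => ->.
  (* Agreements plus disagreements would give [m + d <= k], whereas [m + d = k + 1]. *)
  have := leq_add m_agree (dC x y Cx Cy xy).
  by rewrite card_agree_hamming subnK ?ltnn // leqW.
rewrite -(card_in_imset f_inj); apply: leq_trans (max_card _) _.
by rewrite card_mx mul1n.
Qed.

Lemma reed_solomon_code (F : finFieldType) (Q : finType) (k d : nat) :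
  #|F| = #|Q| -> (k <= #|F|)%N -> (0 < d)%N -> (d <= k)%N ->
  exists2 C : {set 'rV[Q]_k},
    distance_at_least d C & #|C| = (#|Q| ^ (k.+1 - d))%N.
Proof.
move=> FQ kF d0 dk; set m := (k.+1 - d)%N.
pose a (i : 'I_k) : F := enum_val (widen_ord kF i).
have a_inj : injective a.
  by move=> i j /enum_val_inj /(congr1 val) /= ij; apply: val_inj.
(* Field elements are relabelled as letters of [Q]; since [h] is injective, Hamming distances are
   unchanged. *)
pose h (x : F) : Q := enum_val (cast_ord FQ (enum_rank x)).
have h_inj : injective h.
  by move=> x y /enum_val_inj /cast_ord_inj /enum_rank_inj.
pose f (u : 'rV[F]_m) : 'rV[Q]_k := \row_i h (rVpoly u).[a i].
have f_dist u v : u != v -> (d <= hamming (f u) (f v))%N.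
  move=> uv; set S := [set i | f u ord0 i == f v ord0 i].
  (* At most [m - 1 = k - d] agreements leave at least [d] disagreements. *)
  suff Sm : (#|S| < m)%N.
    rewrite -(leq_add2l #|S|) card_agree_hamming -ltnS -addSn.
    by rewrite -(subnK (leqW dk)) leq_add2r.
  have p0 : rVpoly (u - v) != 0.
    apply: contraNneq uv => p0; rewrite -subr_eq0.
    by rewrite -[u - v]rVpolyK p0 linear0.
  (* The points [a i] with [i] in [S] are distinct roots of the nonzero polynomial [rVpoly (u - v)],
     whose size is at most [m]. *)
  rewrite cardE -(size_map a); apply: leq_trans (size_poly _ _).
  apply: (max_poly_roots p0); last by rewrite (map_inj_uniq a_inj) enum_uniq.
  apply/allP => _ /mapP[i iS ->]; move: iS; rewrite mem_enum inE !mxE.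
  by move=> /eqP/h_inj e; rewrite /root linearB /= hornerD hornerN e subrr.
(* As [d] is positive, [f_dist] separates distinct messages, so the code has exactly [#|F| ^ m]
   words. *)
have f_inj : injective f.
  move=> u v fuv; apply/eqP/negPn/negP => /f_dist.
  by rewrite fuv hammingxx leqNgt d0.
exists (f @: setT).
  apply/distance_at_leastP => _ _ /imsetP[u _ ->] /imsetP[v _ ->] fuv.
  by apply: f_dist; apply: contraNneq fuv => ->.
by rewrite (card_imset _ f_inj) cardsT card_mx mul1n FQ.
Qed.

Lemma max_code_sizeE (F : finFieldType) (k d : nat) :
  (k <= #|F|)%N -> (0 < d)%N -> (d <= k)%N ->
  max_code_size #|F| k d = (#|F| ^ (k.+1 - d))%N.
Proof.
move=> kF d0 dk; apply/eqP; rewrite eqn_leq; apply/andP; split.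
  apply/bigmax_leqP => C dC.
  by have := singleton_bound _ _ _ _ d0 dk dC; rewrite card_ord.
have FI : #|F| = #|'I_#|F| | by rewrite card_ord.
have [C dC cC] := reed_solomon_code _ _ _ _ FI kF d0 dk.
rewrite card_ord in cC; rewrite -cC.
exact: (@leq_bigmax_cond _ _ (fun C : {set _} => #|C|)).
Qed.

Theorem proposition1 (R : realType) (q : nat) (hq : prime_power q)
    (F : finFieldType) (hF : #|F| = q) (n k d : nat)
    (hn : (0 < n)%N) (hk0 : (0 < k)%N) (hd : (0 < d)%N)
    (hk2 : (2 <= k)%N) (hkq : (k <= q - 1)%N) (hdk : (d <= k)%N)
    (hMDS : exists C : {vspace 'rV[F]_n}, MDS_code k d C) :
  let r : int := n%:Z - k%:Z in
  r%:~R = k%:R - log_base (q%:R : R) (max_code_size q k d)%:R.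
Proof.
have [_ [_ nE]] := hMDS.
have kF : (k <= #|F|)%N by rewrite hF (leq_trans hkq) ?leq_subr.
have q1 : (1 < #|F|)%N := leq_trans hk2 kF.
have lnq : ln (#|F|%:R : R) != 0 by rewrite gt_eqF // ln_gt0 // ltr1n.
(* The logarithm of [q ^ (k + 1 - d)] is [k + 1 - d], which leaves [n - k = k - (k + 1 - d)], an
   identity once [n = k + d - 1] is substituted. *)
rewrite /= -hF max_code_sizeE // /log_base natrX lnXn ?ltr0n ?(ltnW q1) //.
rewrite -[ln _ *+ _]mulr_natl mulfK // natrB ?leqW // rmorphB /= -!pmulrn.
rewrite nE natrB ?natrD ?addn_gt0 ?hk0 //.
ring.
Qed.
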